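(* Let $f:\mathbb{R}^n\to\mathbb{R}$ be convex and differentiable with $L$-Lipschitz gradient ($L>0$), let $g:\mathbb{R}^n\to\mathbb{R}\cup\{+\infty\}$ be convex, proper and lower semi-continuous, let $F=f+g$ with $\operatorname{argmin}F\ne\emptyset$, $F^\star=\min F$, and assume in addition that $F$ is $\mu$-strongly convex ($\mu>0$). Let $\gamma>0$, $\alpha_k\in[0,1]$ be chosen in one of the regimes: (a) $\gamma<1/L$; or $\gamma=1/L$ and $\alpha_k\le\alpha<1$ for all $k$; (b) $\gamma=1/L$ and $(\alpha_k)$ converges to $1$ at rate $1/k^d$ with $d\in\,]0,1[$; (c) $\gamma=1/L$ and $(\alpha_k)$ converges to $1$ at rate $1/k$. Let $(x_k),(y_k)$ be generated by the proximal gradient algorithm with alternated inertia: for every even $k$, $$y_{k+1}=\mathsf{T}_\gamma(x_k),\qquad x_{k+1}=y_{k+1}+\alpha_k(y_{k+1}-y_k),\qquad y_{k+2}=\mathsf{T}_\gamma(x_{k+1}),\qquad x_{k+2}=y_{k+2}.$$ Then: - (better-than-polynomial rate) in regimes (a) and (b), there is $\nu>0$ such that $F(y_{2k})-F^\star=\mathcal{O}\left(\exp(-\nu k^{1-d})\right)$, where $d=0$ in regime (a) and $d\in\,]0,1[$ is the exponent of regime (b) in that regime; - (iterates convergence) $(y_{2k})$ converges to the unique minimizer $x^\star$ of $F$, at the same rate, i.e. in regimes (a) and (b) also $\|y_{2k}-x^\star\|=\mathcal{O}\left(\exp(-\nu k^{1-d})\right)$ for some $\nu>0$ and the same $d$.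
   Context: $\|\cdot\|$ is the Euclidean norm. $\mathbf{prox}_h(x)=\operatorname{argmin}_w\left(h(w)+\frac12\|w-x\|^2\right)$ and $\mathsf{T}_\gamma(x)=\mathbf{prox}_{\gamma g}(x-\gamma\nabla f(x))$. The algorithm starts from an arbitrary $x_0$ (and $y_0$). ''$(\alpha_k)$ converges to $1$ at rate $1/k^d$'' means that there are constants $0<c_1\le c_2$ with $c_1/k^d\le 1-\alpha_k\le c_2/k^d$ for all large $k$ (and $d=1$ for rate $1/k$). *)

(* Defs.v *)
From HB Require Import structures.
From mathcomp Require Import all_boot all_order all_algebra.
From mathcomp Require Import all_classical all_reals all_analysis.
Set Implicit Arguments.
Unset Strict Implicit.
Unset Printing Implicit Defensive.
Import Order.TTheory GRing.Theory Num.Theory.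
Import numFieldNormedType.Exports.
Local Open Scope classical_set_scope.
Local Open Scope ring_scope.

(* The library norm `|x| on row vectors is the sup norm; its topology, and hence
   convergence, differentiability and lower semicontinuity, is the Euclidean
   one, but Lipschitz constants, strong convexity moduli and proximal operators
   depend on the norm itself. *)
Definition enorm (R : realType) (n : nat) (x : 'rV[R]_n) : R :=
  Num.sqrt (\sum_(i < n) x 0 i ^+ 2).

Definition grad (R : realType) (n : nat) (f : 'rV[R]_n -> R) (x : 'rV[R]_n) :
  'rV[R]_n := \row_i 'D_(delta_mx 0 i) f x.

Definition lipschitz_grad (R : realType) (n : nat) (L : R)
    (f : 'rV[R]_n -> R) : Prop :=
  forall x y, enorm (grad f x - grad f y) <= L * enorm (x - y).

(* In \bar R we have 0 * +oo = 0, so that t = 0 and t = 1 are harmless below. *)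
Definition strongly_convex_ereal (R : realType) (n : nat) (mu : R)
    (h : 'rV[R]_n -> \bar R) : Prop :=
  forall (x y : 'rV[R]_n) (t : R), 0 <= t <= 1 ->
    (h (t *: x + (1 - t) *: y)%R <=
     t%:E * h x + (1 - t)%:E * h y
     - (mu / 2 * t * (1 - t) * enorm (x - y)%R ^+ 2)%:E)%E.

Definition convex_ereal (R : realType) (n : nat) (h : 'rV[R]_n -> \bar R) :
    Prop :=
  forall (x y : 'rV[R]_n) (t : R), 0 <= t <= 1 ->
    (h (t *: x + (1 - t) *: y)%R <= t%:E * h x + (1 - t)%:E * h y)%E.

Definition proper_ereal (R : realType) (n : nat) (h : 'rV[R]_n -> \bar R) : Prop :=
  (forall x, h x != -oo%E) /\ (exists x, (h x < +oo)%E).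

Definition argmin (R : realType) (n : nat) (h : 'rV[R]_n -> \bar R) :
  set 'rV[R]_n := [set w | forall v, (h w <= h v)%E].

(* The default value 0 is returned only if there is no minimizer. *)
Definition prox (R : realType) (n : nat) (h : 'rV[R]_n -> \bar R)
    (x : 'rV[R]_n) : 'rV[R]_n :=
  xget 0 (argmin (fun w => (h w + (2^-1 * enorm (w - x)%R ^+ 2)%:E)%E)).

Definition prox_grad (R : realType) (n : nat) (gamma : R) (f : 'rV[R]_n -> R)
    (g : 'rV[R]_n -> \bar R) (x : 'rV[R]_n) : 'rV[R]_n :=
  prox (fun w => (gamma%:E * g w)%E) (x - gamma *: grad f x).

Definition alternated_inertia (R : realType) (n : nat)
    (T : 'rV[R]_n -> 'rV[R]_n) (alpha : nat -> R) (x y : nat -> 'rV[R]_n) :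
    Prop :=
  forall k, ~~ odd k ->
    [/\ y k.+1 = T (x k),
        x k.+1 = y k.+1 + alpha k *: (y k.+1 - y k),
        y k.+2 = T (x k.+1) &
        x k.+2 = y k.+2].

Definition cvg_to_one_at_rate (R : realType) (alpha : nat -> R) (d : R) :
    Prop :=
  exists c1 c2 : R, [/\ 0 < c1, c1 <= c2 &
    \forall k \near \oo,
      c1 / (k%:R `^ d) <= 1 - alpha k <= c2 / (k%:R `^ d)].

Definition regime_a (R : realType) (L gamma : R) (alpha : nat -> R) : Prop :=
  gamma < L^-1 \/
  (gamma = L^-1 /\ exists a : R, a < 1 /\ forall k, alpha k <= a).

Definition regime_b (R : realType) (L gamma : R) (alpha : nat -> R) (d : R) :
    Prop :=
  [/\ gamma = L^-1, 0 < d < 1 & cvg_to_one_at_rate alpha d].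

Definition regime_c (R : realType) (L gamma : R) (alpha : nat -> R) : Prop :=
  gamma = L^-1 /\ cvg_to_one_at_rate alpha 1.

(* u_k = O(v_k) for an extended real-valued u, where the library's notation
   u =O_\oo v does not apply; u may be +oo at finitely many indices, e.g.
   when the starting point is outside the domain. *)
Definition bigO_ereal (R : realType) (u : nat -> \bar R) (v : nat -> R) :
    Prop :=
  exists C : R, \forall k \near \oo, (`|u k| <= (C * `|v k|)%:E)%E.

Definition objective_rate (R : realType) (n : nat) (F : 'rV[R]_n -> \bar R)
    (y : nat -> 'rV[R]_n) (d : R) : Prop :=
  exists nu : R, 0 < nu /\
    bigO_ereal (fun k => (F (y (2 * k)%N) - ereal_inf (range F))%E)
               (fun k => expR (- (nu * k%:R `^ (1 - d)))).

Definition iterates_rate (R : realType) (n : nat) (xstar : 'rV[R]_n)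
    (y : nat -> 'rV[R]_n) (d : R) : Prop :=
  exists nu : R, 0 < nu /\
    (fun k => enorm (y (2 * k)%N - xstar)) =O_\oo
    (fun k => expR (- (nu * k%:R `^ (1 - d)))).

(* Main.v *)
Require Import Defs.
From HB Require Import structures.
From mathcomp Require Import all_boot all_order all_algebra.
From mathcomp Require Import all_classical all_reals all_analysis.
From mathcomp Require Import ring lra.
Set Implicit Arguments.
Unset Strict Implicit.
Unset Printing Implicit Defensive.
Import Order.TTheory GRing.Theory Num.Theory.
Import numFieldNormedType.Exports.
Local Open Scope classical_set_scope.
Local Open Scope ring_scope.

(** Over two consecutive iterations the algorithm never increases [F]: it goes
    from [u = y (2 k)] to [v = T u], extrapolates to [w = v + a (v - u)] and ends
    at [u' = T w]. Everything follows from the three-point inequality of the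
    forward-backward step ([prox_grad_three_point]), valid for every [z],
      F (T x) + |T x - z|^2 / (2 gamma) + (1/gamma - L) |T x - x|^2 / 2
        <= F z + |x - z|^2 / (2 gamma).
    Used at [x = u, z = u] and at [x = w, z = v], it shows that two steps gain
      F u - F u' >= c |v - u|^2 / (2 gamma),  c = (1 - a) + (1 - gamma L).
    Used at [x = u, z = xstar], together with the quadratic growth
    [mu/4 |z - xstar|^2 <= F z - F xstar] given by strong convexity, it bounds the
    remaining error: F u' - F xstar is at most a constant times |v - u|^2.
    Eliminating [|v - u|] gives ([two_step_contraction])
      (F u' - F xstar) (1 + kappa c) <= F u - F xstar,
    with [kappa] depending on [gamma * mu] only.

    The regimes enter only through a lower bound [c_k >= c0 / k^d] on the gain,
    with [d = 0] in regime (a), the given exponent in regime (b) and [d = 1] in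
    regime (c). Multiplying the factors [1 + kappa c_k] compares the error with
    [exp (- nu phi_k)] for any [phi] whose increments are at most [k^-d]
    ([exp_decay_of_contraction]): [phi_k = k^(1-d)] works for the first two
    regimes and [phi_k = ln k] for the third. Since [d <= 1] always, the
    logarithmic comparison alone gives convergence of the iterates in every
    regime; quadratic growth turns each rate on [F] into a rate on the iterates,
    with the exponent halved.

    Two facts on which the three-point inequality rests need an argument of their
    own. The inequality [f w <= f x + <grad f x, w - x> + L/2 |w - x|^2] comes
    from the mean value theorem on a segment ([descent_inequality]). The proximal point
    exists because [g] has an affine minorant: the gradient of [f] at a minimizer
    of [F] provides one. That minorant, the optimality condition of the proximal
    point and the gradient inequality of a convex function are three instances
    of the single lemma [min_tangent]. *)

(** * Euclidean geometry of row vectors *)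

Definition dotp (R : realType) (n : nat) (u v : 'rV[R]_n) : R :=
  \sum_(i < n) u 0 i * v 0 i.

Section Euclidean.
Context {R : realType} {n : nat}.
Implicit Types (u v w : 'rV[R]_n) (a : R).

Lemma dotpC u v : dotp u v = dotp v u.
Proof. by apply: eq_bigr => i _; rewrite mulrC. Qed.

Lemma dotpDl u v w : dotp (u + v) w = dotp u w + dotp v w.
Proof. by rewrite -big_split; apply: eq_bigr => i _; rewrite mxE mulrDl. Qed.

Lemma dotpZl a u v : dotp (a *: u) v = a * dotp u v.
Proof. by rewrite mulr_sumr; apply: eq_bigr => i _; rewrite mxE mulrA. Qed.

Lemma dotpNl u v : dotp (- u) v = - dotp u v.
Proof. by rewrite -scaleN1r dotpZl mulN1r. Qed.

Lemma dotp0l v : dotp 0 v = 0.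
Proof. by rewrite -(scale0r 0) dotpZl mul0r. Qed.

Lemma dotpDr u v w : dotp w (u + v) = dotp w u + dotp w v.
Proof. by rewrite !(dotpC w) dotpDl. Qed.

Lemma dotpZr a u v : dotp u (a *: v) = a * dotp u v.
Proof. by rewrite !(dotpC u) dotpZl. Qed.

Lemma dotpNr u v : dotp u (- v) = - dotp u v.
Proof. by rewrite !(dotpC u) dotpNl. Qed.

Definition dotpE := (dotpDl, dotpDr, dotpNl, dotpNr, dotpZl, dotpZr).

Lemma dotp_ge0 u : 0 <= dotp u u.
Proof. by apply: sumr_ge0 => i _; rewrite -expr2 sqr_ge0. Qed.

Lemma enorm_sqr u : enorm u ^+ 2 = dotp u u.
Proof.
rewrite /enorm sqr_sqrtr; last by apply: sumr_ge0 => i _; exact: sqr_ge0.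
by apply: eq_bigr => i _; rewrite expr2.
Qed.

Lemma enorm_ge0 u : 0 <= enorm u.
Proof. exact: sqrtr_ge0. Qed.

(** Transfers Euclidean estimates to the topology of row vectors, which is
    induced by the sup norm. *)
Lemma mx_norm_le_enorm u : `|u| <= enorm u.
Proof.
rewrite [leLHS]/Num.norm /= mx_normrE; apply/bigmax_leP.
split; first exact: enorm_ge0.
move=> [i j] _ /=; rewrite (ord1 i) -sqrtr_sqr ler_wsqrtr//.
by rewrite (bigD1 j)//= lerDl; apply: sumr_ge0 => k _; exact: sqr_ge0.
Qed.

Lemma enorm_eq0 u : enorm u = 0 -> u = 0.
Proof.
by move=> u0; apply/eqP; rewrite -normr_le0 -u0 mx_norm_le_enorm.
Qed.

Lemma enormN u : enorm (- u) = enorm u.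
Proof. by congr Num.sqrt; apply: eq_bigr => i _; rewrite mxE sqrrN. Qed.

(** Expand the squared norm of the combination [|v| u - |u| v], whose two terms
    have equal length. *)
Lemma cauchy_schwarz u v : dotp u v <= enorm u * enorm v.
Proof.
have [/enorm_eq0 ->|u0] := eqVneq (enorm u) 0.
  by rewrite dotp0l mulr_ge0 ?enorm_ge0.
have [/enorm_eq0 ->|v0] := eqVneq (enorm v) 0.
  by rewrite dotpC dotp0l mulr_ge0 ?enorm_ge0.
have uv0 : 0 < enorm u * enorm v.
  by rewrite mulr_gt0// lt_def enorm_ge0 ?u0 ?v0.
have := dotp_ge0 (enorm v *: u - enorm u *: v).
rewrite !dotpE (dotpC v u) -!enorm_sqr => h.
rewrite -subr_ge0 -(pmulr_rge0 _ uv0); lra.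
Qed.

Lemma dotp_continuous p : continuous (fun w : 'rV[R]_n => dotp (w - p) (w - p)).
Proof.
apply: continuous_big => [|i _ w]; first exact: add_continuous.
have h : (fun w : 'rV[R]_n => (w - p) 0 i) @ w --> (w - p) 0 i.
  have -> : (fun w : 'rV[R]_n => (w - p) 0 i) = (fun w => w 0 i - p 0 i).
    by apply/funext => z; rewrite !mxE.
  rewrite !mxE.
  exact: (cvgB (@coord_continuous R 1 n 0 i w) (cvg_cst _)).
exact: (cvgM h h).
Qed.

End Euclidean.

(** * Functions with a Lipschitz gradient *)

Section Smooth.
Context {R : realType} {n : nat}.
Implicit Types (f : 'rV[R]_n -> R) (x h : 'rV[R]_n).

Lemma dotp_grad f x h : differentiable f x -> dotp (grad f x) h = 'D_h f x.
Proof.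
move=> df; rewrite deriveE// {2}(row_sum_delta h) linear_sum.
apply: eq_bigr => i _; rewrite linearZ /= mxE deriveE//.
by rewrite /GRing.scale/= mulrC.
Qed.

Lemma is_derive_line f x h (t : R) : differentiable f (x + t *: h) ->
  is_derive t (1 : R) (fun s : R => f (x + s *: h))
    (dotp (grad f (x + t *: h)) h).
Proof.
move=> df; rewrite dotp_grad//.
(* Both derivatives are limits of the same difference quotient. *)
have E : (fun s : R => s^-1 *:
      (((fun s => f (x + s *: h)) \o shift t) (s *: (1 : R))
           - f (x + t *: h))) =
    (fun s => s^-1 *: ((f \o shift (x + t *: h)) (s *: h) - f (x + t *: h))).
  apply/funext => s /=; congr (_ *: (f _ - _)).
  by rewrite scalerDl [s *: 1]mulr1 addrCA.
apply: DeriveDef; last by rewrite /derive E.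
by rewrite /derivable E; exact: diff_derivable.
Qed.

(** Along the segment, subtract from [f] the candidate quadratic upper bound: by
    Cauchy-Schwarz and the Lipschitz condition the difference has a nonpositive
    derivative, so the mean value theorem concludes. *)
Lemma descent_inequality (L : R) f x h : (forall z, differentiable f z) ->
  lipschitz_grad L f ->
  f (x + h) <= f x + dotp (grad f x) h + L / 2 * dotp h h.
Proof.
move=> df lip.
pose psi (t : R) := f (x + t *: h)
  - (dotp (grad f x) h * t + L / 2 * dotp h h * t ^+ 2).
pose dpsi (t : R) := dotp (grad f (x + t *: h)) h
  - (dotp (grad f x) h + L * dotp h h * t).
have Dpsi t : is_derive t (1 : R) psi (dpsi t).
  have ? := is_derive_line (df (x + t *: h)).
  apply: is_derive_eq.
  rewrite /dpsi /GRing.scale /=; by field.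
have cpsi : {within `[0, 1], continuous psi}.
  by apply: derivable_within_continuous => t _; have [] := Dpsi t.
have [c /itvP c01] := MVT ltr01 (fun t _ => Dpsi t) cpsi.
rewrite /psi scale1r scale0r addr0 => psi1.
suff : dpsi c <= 0 by move: psi1; lra.
have := cauchy_schwarz (grad f (x + c *: h) - grad f x) h.
have := lip (x + c *: h) x.
rewrite [_ + _ - x]addrC addKr.
have -> : enorm (c *: h) = c * enorm h.
  rewrite -[LHS]ger0_norm ?enorm_ge0// -sqrtr_sqr enorm_sqr !dotpE -enorm_sqr.
  by rewrite mulrA -expr2 -exprMn sqrtr_sqr ger0_norm ?mulr_ge0 ?enorm_ge0 ?c01.
move=> /(ler_wpM2r (enorm_ge0 h)) l /le_trans/(_ l).
rewrite /dpsi !dotpE -enorm_sqr; lra.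
Qed.

End Smooth.

(** * First-order conditions for convex functions *)

Section Convex.
Context {R : realType} {n : nat}.
Implicit Types (f phi : 'rV[R]_n -> R) (g : 'rV[R]_n -> \bar R).

Lemma le0_of_le_small (A B : R) : (forall t, 0 < t <= 1 -> A <= B * t) -> A <= 0.
Proof.
move=> AB; rewrite leNgt; apply/negP => A0.
have S0 : 0 < 2 * (`|B| + A) by rewrite mulr_gt0// ltr_wpDl.
have B0 := normr_ge0 B; have BB := ler_norm B.
have /AB : 0 < A / (2 * (`|B| + A)) <= 1.
  by rewrite divr_gt0//= ler_pdivrMr// mul1r; lra.
by rewrite mulrA ler_pdivlMr// => ?; nra.
Qed.

(** Move from the minimizer [w] a fraction [t] of the way to [z]: convexity
    bounds [g] by its chord, the hypothesis bounds [phi] by its quadratic model,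
    and minimality compares the sum with the value at [w]. Dividing by [t] and
    letting [t] tend to 0 leaves the linear part. This is the optimality
    condition of a smooth plus nonsmooth sum, without subdifferentials. *)
Lemma min_tangent phi g (a w : 'rV[R]_n) (C : R) :
  convex_ereal g -> g w \is a fin_num ->
  (forall z, ((phi w)%:E + g w <= (phi z)%:E + g z)%E) ->
  (forall h, phi (w + h) <= phi w + dotp a h + C * dotp h h) ->
  forall z, (g w + (- dotp a (z - w))%:E <= g z)%E.
Proof.
move=> gcvx gw wmin phiC z.
case gwE : (g w) gw => [r0| |] // _.
case gzE : (g z) => [r| |]; last 2 first.
- by rewrite leey.
- by have := wmin z; rewrite gwE gzE.
rewrite -EFinD lee_fin -subr_le0.
apply: (@le0_of_le_small _ (C * dotp (z - w) (z - w))) => t t01.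
have t0 : 0 < t by case/andP: t01.
have t01' : 0 <= t <= 1 by move: t01 => /andP[/ltW -> ->].
have := le_trans (wmin (t *: z + (1 - t) *: w)) (leeD2l _ (gcvx z w t t01')).
rewrite gwE gzE -!EFinM -!EFinD lee_fin.
have -> : t *: z + (1 - t) *: w = w + t *: (z - w).
  by rewrite scalerBl scale1r scalerBr addrCA addrA addrC addrA [- _ + _]addrC.
have := phiC (t *: (z - w)); rewrite !dotpE => h1 h2.
rewrite -subr_ge0 -(pmulr_rge0 _ t0); move: h1 h2; lra.
Qed.

(** Every point minimizes [- f + f = 0], so [min_tangent] applies with
    [phi := - f], the quadratic model of [- f] being the descent inequality for
    the negated function. *)
Lemma convex_gradient_ineq (L : R) f (x z : 'rV[R]_n) :
  convex_function [set: convex_lmodType 'rV[R]_n] f ->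
  (forall z, differentiable f z) -> lipschitz_grad L f ->
  f x + dotp (grad f x) (z - x) <= f z.
Proof.
move=> fcvx fd flip.
have fcvx' : convex_ereal (fun z => (f z)%:E).
  move=> u v t /andP[t0 t1]; rewrite -!EFinM -EFinD lee_fin.
  have ti : Itv.spec (@Itv.num_sem R) (Itv.Real `[0%Z, 1%Z]) t.
    by rewrite /= /Itv.num_sem/= num_real /= in_itv/= t0 t1.
  exact: (fcvx (Itv.mk ti) u v (in_setT _) (in_setT _)).
have fdN y : differentiable (fun z => - f z) y by exact: differentiableN.
have gradN y : grad (fun z => - f z) y = - grad f y.
  by apply/rowP => i; rewrite !mxE deriveN//; exact: diff_derivable.
have flipN : lipschitz_grad L (fun z => - f z).
  by move=> u v; rewrite !gradN -opprD enormN; exact: flip.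
have := @min_tangent (fun z => - f z) (fun z => (f z)%:E) (- grad f x) x (L / 2)
  fcvx' isT _ _ z.
rewrite -EFinD lee_fin dotpNl opprK; apply.
- by move=> y; rewrite -!EFinD !addNr.
- by move=> h; rewrite -gradN; exact: descent_inequality.
Qed.

End Convex.

(** * Existence of proximal points *)

(** The sublevel sets of [h] generate a proper filter, since any two of them are
    nested. By compactness it has a cluster point [p]; a value [h v < h p] would,
    by lower semicontinuity, separate [p] from the sublevel set of [v]. *)
Lemma lsc_argmin_nonempty (R : realType) (n : nat)
    (h : 'rV[R]_n -> \bar R) (x0 : 'rV[R]_n) :
  lower_semicontinuous h -> (forall z, h z != -oo%E) -> (h x0 < +oo)%E ->
  bounded_set [set w | (h w <= h x0)%E] ->
  argmin h !=set0.
Proof.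
move=> hlsc hNoo hx0 bdd.
pose A := [set w | (h w <= h x0)%E].
have fin v w : (h v < h w)%E -> h v \is a fin_num.
  by move=> vw; rewrite fin_numE hNoo/= lt_eqF// (lt_le_trans vw) ?leey.
have cA : compact A.
  apply: bounded_closed_compact => //.
  have -> : A = ~` [set w | ((fine (h x0))%:E < h w)%E].
    apply/seteqP; split => w /=; rewrite /A/= fineK ?fin_numE ?hNoo ?lt_eqF//.
      by move=> ?; apply/negP; rewrite -leNgt.
    by move=> /negP; rewrite -leNgt.
  by apply: open_closedC; move/lower_semicontinuousP : hlsc; exact.
pose G := filter_from [set: 'rV[R]_n] (fun v => [set w | (h w <= h v)%E]).
have GF : ProperFilter G.
  apply: filter_from_proper; last by move=> v _; exists v => /=.
  apply: filter_from_filter; first by exists x0.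
  move=> u v _ _; have [uv|/ltW vu] := leP (h u) (h v).
    by exists u => // w /= wu; split => //=; exact: le_trans uv.
  by exists v => // w /= wv; split => //=; exact: le_trans vu.
have [|p [Ap clp]] := cA G GF; first by exists x0.
exists p => v; rewrite leNgt; apply/negP => vp.
have hv := fin _ _ vp.
have [|V Vp VA] := hlsc p (fine (h v)); first by rewrite fineK.
have [|w [/= wv /VA]] := clp [set w | (h w <= h v)%E] V _ Vp; first by exists v.
by rewrite fineK// ltNge wv.
Qed.

Section ProximalStep.
Context {R : realType} {n : nat}.
Variables (g : 'rV[R]_n -> \bar R) (gamma : R).
Hypotheses (g_proper : proper_ereal g) (gamma_gt0 : 0 < gamma).

Lemma prox_objective_lsc (p : 'rV[R]_n) : lower_semicontinuous g ->
  lower_semicontinuous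
    (fun w => (gamma%:E * g w + (2^-1 * enorm (w - p) ^+ 2)%:E)%E).
Proof.
move=> g_lsc w b bw.
pose q z : R := 2^-1 * enorm (z - p) ^+ 2.
(* [c] is the value of [g w] at which the objective would equal [b]. *)
pose c := (b - q w) / gamma.
have [c' cc' c'w] : exists2 c' : R, c < c' & (c'%:E < g w)%E.
  case gwE : (g w) bw => [r| |] bw.
  - have cr : c < r.
      by move: bw; rewrite -EFinM -EFinD lte_fin /c ltr_pdivrMr// -/(q w); lra.
    by exists ((c + r) / 2); rewrite ?lte_fin; lra.
  - by exists (c + 1); [lra|rewrite ltry].
  - by case: g_proper => /(_ w); rewrite gwE.
have [V Vw Vg] := g_lsc w c' c'w.
have qc : q z @[z --> w] --> q w.
  have -> : q = (fun z => 2^-1 * dotp (z - p) (z - p)).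
    by apply/funext => z; rewrite /q enorm_sqr.
  exact: (cvgM (cvg_cst _) (@dotp_continuous _ _ p w)).
have e0 : 0 < gamma * (c' - c) by rewrite mulr_gt0// subr_gt0.
have qz : \forall z \near w, q w - gamma * (c' - c) < q z.
  by apply: cvgr_gt qc _ _; rewrite ltrBlDr ltrDl.
exists (V `&` [set z | q w - gamma * (c' - c) < q z]); first exact: filterI.
move=> z [/Vg gz /= qwz].
have : (gamma%:E * c'%:E + (q z)%:E <= gamma%:E * g z + (q z)%:E)%E.
  by rewrite leeD2r// lee_wpmul2l ?lee_fin ?ltW.
apply: lt_le_trans; rewrite -EFinM -EFinD lte_fin.
have : c * gamma = b - q w by rewrite /c divfK ?gt_eqF.
by move: qwz; lra.
Qed.

(** The affine minorant of [g] makes the objective coercive: on the sublevel set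
    of [x0] one gets [|w - x0|^2 <= 2 <b, w - x0>] for a fixed vector [b], hence a
    bounded set, and [lsc_argmin_nonempty] applies. *)
Lemma prox_argmin (x0 a p : 'rV[R]_n) :
  lower_semicontinuous g -> g x0 \is a fin_num ->
  (forall z, (g x0 + (- dotp a (z - x0))%:E <= g z)%E) ->
  argmin (fun w => (gamma%:E * g w + (2^-1 * enorm (w - p) ^+ 2)%:E)%E)
         (prox (fun w => (gamma%:E * g w)%E) p).
Proof.
move=> g_lsc g_fin g_minor; rewrite /prox.
set h := (fun w => _ + _)%E; case: xgetP => // /(_ _) noargmin.
suff [w /noargmin] : argmin h !=set0 by [].
have hE w : h w = (gamma%:E * g w + (2^-1 * enorm (w - p) ^+ 2)%:E)%E by [].
case g0E : (g x0) g_fin g_minor => [r0| |] // _ g_minor.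
apply: (@lsc_argmin_nonempty _ _ h x0).
- exact: prox_objective_lsc.
- move=> z; rewrite hE; case gzE : (g z) => [r| |] //.
    by rewrite gt0_muley ?lte_fin.
  by case: g_proper => /(_ z); rewrite gzE.
- by rewrite hE g0E -EFinM -EFinD ltry.
pose b := gamma *: a + p - x0.
exists (`|x0| + 2 * enorm b); split; first exact: num_real.
move=> M ltM w /=; rewrite !hE g0E => hw.
have gw : (gamma%:E * (r0%:E + (- dotp a (w - x0))%:E)
     + (2^-1 * enorm (w - p) ^+ 2)%:E
   <= gamma%:E * r0%:E + (2^-1 * enorm (x0 - p) ^+ 2)%:E)%E.
  apply: le_trans hw; rewrite leeD2r//.
  by apply: lee_wpmul2l; [rewrite lee_fin ltW|exact: g_minor].
have {}gw : enorm (w - x0) ^+ 2 <= 2 * dotp b (w - x0).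
  move: gw; rewrite -EFinD -!EFinM -!EFinD lee_fin !enorm_sqr /b !dotpE.
  rewrite (dotpC w x0) (dotpC w p) (dotpC x0 p); lra.
have wx0 : enorm (w - x0) <= 2 * enorm b.
  have := cauchy_schwarz b (w - x0).
  by have := enorm_ge0 (w - x0); have := enorm_ge0 b; nra.
apply: le_trans (ltW ltM).
rewrite -[X in `|X| <= _](subrK x0) addrC (le_trans (ler_normD _ _))// lerD2l.
exact: le_trans (mx_norm_le_enorm _) wx0.
Qed.

(** Sum of three inequalities: the optimality condition of the proximal point
    between [w] and [z] for [g], the gradient inequality at [x] towards [z] for
    [f], and the descent inequality from [x] to [w] for [f]; the scalar products
    left over combine into squared distances. *)
Lemma prox_grad_three_point (f : 'rV[R]_n -> R) (L : R) (x0 a x : 'rV[R]_n) :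
  convex_function [set: convex_lmodType 'rV[R]_n] f ->
  (forall z, differentiable f z) -> lipschitz_grad L f ->
  convex_ereal g -> lower_semicontinuous g -> g x0 \is a fin_num ->
  (forall z, (g x0 + (- dotp a (z - x0))%:E <= g z)%E) ->
  let w := prox_grad gamma f g x in
  g w \is a fin_num /\
  forall z, g z \is a fin_num ->
    f w + fine (g w) + gamma^-1 / 2 * dotp (w - z) (w - z)
      + (gamma^-1 - L) / 2 * dotp (w - x) (w - x)
    <= f z + fine (g z) + gamma^-1 / 2 * dotp (x - z) (x - z).
Proof.
move=> f_cvx f_diff f_lip g_cvx g_lsc g_fin g_minor w.
set p := x - gamma *: grad f x.
have wmin : argmin (fun u =>
    (gamma%:E * g u + (2^-1 * enorm (u - p) ^+ 2)%:E)%E) w.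
  exact: prox_argmin g_minor.
have gw_fin : g w \is a fin_num.
  have := wmin x0; rewrite -(fineK g_fin).
  case gwE : (g w) => [r| |] //.
    by rewrite gt0_muley ?lte_fin.
  by case: g_proper => /(_ w); rewrite gwE.
split => // z gz_fin.
have aE : gamma^-1 *: (w - x) + grad f x = gamma^-1 *: (w - p).
  by apply/rowP => i; rewrite !mxE; field; rewrite gt_eqF.
clearbody p.
have tangent : fine (g w) - dotp (gamma^-1 *: (w - x) + grad f x) (z - w)
    <= fine (g z).
  rewrite -lee_fin EFinB !fineK//.
  apply: (@min_tangent _ _ (fun u => gamma^-1 / 2 * dotp (u - p) (u - p)) g _ _
    (gamma^-1 / 2)) => // [u|h].
  - have := wmin u; rewrite -(fineK gw_fin) !enorm_sqr.
    case guE : (g u) => [r| |]; last 2 first.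
    - by rewrite addey// leey.
    - by case: g_proper => /(_ u); rewrite guE.
    rewrite -!EFinM -!EFinD !lee_fin => h.
    rewrite -(ler_pM2l gamma_gt0) !mulrDr !mulrA mulfV ?gt_eqF//; lra.
  - by rewrite aE !dotpE (dotpC h w) (dotpC h p); lra.
have f_conv := convex_gradient_ineq x z f_cvx f_diff f_lip.
have := descent_inequality x (w - x) f_diff f_lip; rewrite addrC subrK => f_desc.
move: tangent f_conv f_desc; rewrite !dotpE.
rewrite (dotpC w x) (dotpC w z) (dotpC x z); lra.
Qed.

End ProximalStep.

(** * Contraction of the objective over two steps *)

(** The constant comes from balancing Young's inequality against quadratic growth
    in [two_step_contraction]. *)
Definition contraction_constant (R : realType) (gamma mu : R) : R :=
  (2 * (4 / (gamma * mu) + 2))^-1.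

Lemma contraction_constant_gt0 (R : realType) (gamma mu : R) :
  0 < gamma -> 0 < mu -> 0 < contraction_constant gamma mu.
Proof.
by move=> g0 m0; rewrite invr_gt0 mulr_gt0// addr_gt0// divr_gt0// mulr_gt0.
Qed.

Section Contraction.
Context {R : realType} {n : nat}.

Lemma dotp_young (s : R) (u v : 'rV[R]_n) : 0 < s ->
  dotp (u + v) (u + v) <= (1 + s) * dotp u u + (1 + s^-1) * dotp v v.
Proof.
move=> s0; have := dotp_ge0 (s *: u - v).
rewrite !dotpE (dotpC v u) => h.
have s1 : s * s^-1 = 1 by rewrite mulfV ?gt_eqF.
rewrite -subr_ge0 -(pmulr_rge0 _ s0).
have -> : s * ((1 + s) * dotp u u + (1 + s^-1) * dotp v v -
    (dotp u u + dotp u v + (dotp u v + dotp v v))) =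
  s * s * dotp u u + (s * s^-1) * dotp v v - 2 * s * dotp u v by ring.
by rewrite s1; lra.
Qed.

(** With [w] the extrapolated point, the decrease [Phi u - Phi (T w)] and the final
    error are both compared with [d = |T u - u|^2]: the decrease is at least
    [c d / (2 gamma)] for [c = (1 - a) + (1 - gamma L)], and the error at most
    [(s + 2) d / gamma] for [s = 4 / (gamma mu)]. *)
Lemma two_step_contraction (Phi : 'rV[R]_n -> R) (D : set 'rV[R]_n)
    (T : 'rV[R]_n -> 'rV[R]_n) (gamma L mu a : R) (u xs : 'rV[R]_n) :
  0 < gamma -> gamma * L <= 1 -> 0 < mu -> 0 <= a <= 1 ->
  (forall x, D (T x) /\ forall z, D z ->
    Phi (T x) + gamma^-1 / 2 * dotp (T x - z) (T x - z)
      + (gamma^-1 - L) / 2 * dotp (T x - x) (T x - x)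
    <= Phi z + gamma^-1 / 2 * dotp (x - z) (x - z)) ->
  (forall z, D z -> mu / 4 * dotp (z - xs) (z - xs) <= Phi z - Phi xs) ->
  D u -> D xs ->
  (Phi (T (T u + a *: (T u - u))) - Phi xs)
    * (1 + contraction_constant gamma mu * ((1 - a) + (1 - gamma * L)))
  <= Phi u - Phi xs.
Proof.
move=> gamma0 gL mu0 /andP[a0 a1] threept growth Du Dxs.
set v := T u; set w := v + a *: (v - u); set u' := T w.
have [Dv v_pt] := threept u; have [Du' u'_pt] := threept w.
rewrite -/v in Dv v_pt; rewrite -/u' in Du' u'_pt.
set i := gamma^-1; have i0 : 0 < i by rewrite invr_gt0.
have ig : i * gamma = 1 by rewrite mulVf ?gt_eqF.
have iL : 0 <= i - L by rewrite -(pmulr_rge0 _ gamma0) mulrBr mulrC ig subr_ge0.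
(* With this weight Young's inequality charges to [|v - xs|^2] only what
   quadratic growth can pay with half of [Phi v - Phi xs]. *)
set s := 4 / (gamma * mu).
have s0 : 0 < s by rewrite divr_gt0// mulr_gt0.
have isV : i * s^-1 = mu / 4.
  by rewrite /s /i; field; rewrite !gt_eqF.
have d0 := dotp_ge0 (v - u); set d := dotp (v - u) (v - u) in d0 *.
have h1 : Phi v + i / 2 * d + (i - L) / 2 * d <= Phi u.
  have := v_pt u Du; rewrite subrr -/d -/i.
  by rewrite dotp0l mulr0 addr0.
have h3 : Phi u' <= Phi v + i / 2 * (a ^+ 2 * d).
  have wv : w - v = a *: (v - u) by rewrite /w addrAC subrr add0r.
  have := u'_pt v Dv; rewrite -/i wv !dotpZl !dotpZr mulrA -expr2 -/d.
  have : 0 <= (i - L) / 2 * dotp (u' - w) (u' - w).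
    by rewrite mulr_ge0 ?divr_ge0 ?dotp_ge0.
  have : 0 <= i / 2 * dotp (u' - v) (u' - v).
    by rewrite mulr_ge0 ?divr_ge0 ?dotp_ge0 ?ltW.
  lra.
have h2 : Phi v - Phi xs <= i * (1 + s) * d.
  have := v_pt xs Dxs; rewrite -/i.
  have := growth v Dv.
  have := dotp_young (u - v) (v - xs) s0; rewrite addrA subrK.
  have -> : dotp (u - v) (u - v) = d by rewrite -opprB dotpNl dotpNr opprK.
  rewrite -/d; set e := dotp (v - xs) (v - xs); set e' := dotp (u - xs) (u - xs).
  move=> /(ler_wpM2l (ltW i0)) yg gr.
  have {}yg : i * e' <= i * (1 + s) * d + (i + mu / 4) * e.
    by apply: le_trans yg _; rewrite -isV; lra.
  have : 0 <= (i - L) / 2 * d by rewrite mulr_ge0// divr_ge0.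
  move: gr yg; lra.
set c := (1 - a) + (1 - gamma * L).
have c0 : 0 <= c by rewrite addr_ge0 ?subr_ge0.
have a2 : a ^+ 2 <= a by rewrite expr2 ler_piMl.
have h4 : Phi u' - Phi xs <= i * (s + 2) * d.
  have : a ^+ 2 * d <= d by rewrite ler_piMl// (le_trans a2).
  move=> /(ler_wpM2l (ltW i0)); have : 0 <= i * d by rewrite mulr_ge0// ltW.
  move: h2 h3; lra.
have h5 : i / 2 * d * c <= Phi u - Phi u'.
  have iLE : i - L = i * (1 - gamma * L) by rewrite mulrBr mulr1 mulrA ig mul1r.
  move: h1 h3; rewrite iLE /c => h1 h3.
  have : 0 <= i * d * (a - a ^+ 2) by rewrite !mulr_ge0 ?subr_ge0// ltW.
  move: h1 h3; lra.
rewrite /contraction_constant -/s -/c.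
have s20 : 0 < s + 2 by rewrite addr_gt0.
have : (Phi u' - Phi xs) * ((2 * (s + 2))^-1 * c) <= i / 2 * d * c.
  rewrite mulrA ler_wpM2r// ler_pdivrMr ?mulr_gt0//.
  by apply: le_trans h4 _; rewrite le_eqVlt; apply/orP; left; apply/eqP; field.
by move: h5; lra.
Qed.

End Contraction.

(** * From contraction factors to rates *)

Section Rates.
Context {R : realType}.
Implicit Types (e c : nat -> R) (d : R).

Lemma powR_nat_ge1 (k : nat) d : (0 < k)%N -> 0 <= d -> 1 <= k%:R `^ d :> R.
Proof. by move=> k0 d0; rewrite -[leLHS](powRr0 k%:R) ler_powR// ler1n. Qed.

(** Write [k^(1-d)] as [k / k^d] and use that the denominator increases. *)
Lemma powR_nat_increment (k : nat) d : (0 < k)%N -> 0 <= d ->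
  k.+1%:R `^ (1 - d) <= k%:R `^ (1 - d) + (k%:R `^ d)^-1 :> R.
Proof.
move=> k0 d0.
have split_pow (m : nat) : (0 < m)%N -> m%:R `^ (1 - d) = m%:R / m%:R `^ d :> R.
  move=> m0; rewrite powRD; last by rewrite pnatr_eq0 -lt0n m0 implybT.
  by rewrite powRr1// powRN.
rewrite !split_pow// -[X in _ <= _ + X]mul1r -mulrDl -natr1.
rewrite ler_wpM2l// lef_pV2 ?posrE ?powR_gt0 ?ltr0n//.
by rewrite ge0_ler_powR ?nnegrE// lerDl.
Qed.

Lemma ln_nat_increment (k : nat) : (0 < k)%N ->
  ln k.+1%:R <= ln k%:R + (k%:R `^ 1)^-1 :> R.
Proof.
move=> k0; have kR : 0 < k%:R :> R by rewrite ltr0n.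
have -> : k.+1%:R = k%:R * (1 + k%:R^-1) :> R.
  by rewrite mulrDr mulr1 mulfV ?gt_eqF// natr1.
rewrite lnM ?posrE ?addr_gt0 ?invr_gt0// powRr1//.
by rewrite lerD2l le_ln1Dx// (lt_trans (ltrN10 _)) ?invr_gt0.
Qed.

(** The exponent [nu = kappa / (1 + kappa)] is chosen so that
    [1 <= (1 - nu s) (1 + kappa s)] for every [s] in the unit interval; then each
    step multiplies [e] by at most [exp (- nu t_k)]. *)
Lemma exp_decay_of_contraction e (t phi : nat -> R) (kappa : R) : 0 < kappa ->
  (\forall k \near \oo, [/\ 0 <= e k, 0 <= t k <= 1,
     e k.+1 * (1 + kappa * t k) <= e k & phi k.+1 <= phi k + t k]) ->
  exists nu C : R, [/\ 0 < nu, 0 <= C &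
    \forall k \near \oo, e k <= C * expR (- (nu * phi k))].
Proof.
move=> kappa0 [N _ step].
pose nu := kappa / (1 + kappa).
have k10 : 0 < 1 + kappa by rewrite addr_gt0.
have nu0 : 0 < nu by rewrite divr_gt0.
have nuE : nu * (1 + kappa) = kappa by rewrite divfK ?gt_eqF.
pose C := e N * expR (nu * phi N).
have eN : 0 <= e N by case: (step N (leqnn _)).
exists nu, C; split => //; first by rewrite mulr_ge0 ?expR_ge0.
exists N => //= k /subnKC <-; elim: (k - N)%N => [|j IH].
  by rewrite addn0 /C -mulrA -expRD subrr expR0 mulr1.
rewrite addnS; set m := (N + j)%N in IH *.
have [em /andP[t0 t1] eS phiS] := step m (leq_addr _ _).
have kt0 : 0 < 1 + kappa * t m by rewrite ltr_pwDl// mulr_ge0// ltW.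
have e1 : expR (- (nu * t m)) * (1 + kappa * t m) >= 1.
  have h : 1 - nu * t m <= expR (- (nu * t m)) by exact: expR_ge1Dx.
  apply: le_trans (ler_wpM2r (ltW kt0) h).
  have : 0 <= nu * kappa * t m * (1 - t m).
    by rewrite mulr_ge0 ?subr_ge0// mulr_ge0// ltW// mulr_gt0.
  have : nu * t m + nu * kappa * t m = kappa * t m by rewrite -{2}nuE; ring.
  lra.
have : e m.+1 <= e m * expR (- (nu * t m)).
  rewrite -(ler_pM2r kt0) -mulrA (le_trans eS)// ler_peMr//.
move/le_trans; apply.
apply: le_trans (ler_wpM2r (expR_ge0 _) IH) _.
rewrite -mulrA -expRD; apply: ler_wpM2l; first by rewrite mulr_ge0 ?expR_ge0.
by rewrite ler_expR -opprD lerN2 -mulrDr ler_wpM2l// ltW.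
Qed.

Lemma gap_decay e c (phi : nat -> R) d kappa : 0 < kappa -> 0 <= d ->
  (forall k, (0 < k)%N -> 0 <= e k /\ e k.+1 * (1 + kappa * c k) <= e k) ->
  (exists2 c0, 0 < c0 & \forall k \near \oo, c0 / k%:R `^ d <= c k) ->
  (forall k, (0 < k)%N -> phi k.+1 <= phi k + (k%:R `^ d)^-1) ->
  exists nu C : R, [/\ 0 < nu, 0 <= C &
    \forall k \near \oo, e k <= C * expR (- (nu * phi k))].
Proof.
move=> kappa0 d0 step [c0 c00 cP] phiP.
apply: (@exp_decay_of_contraction e (fun k => (k%:R `^ d)^-1) phi (kappa * c0)).
  exact: mulr_gt0.
near=> k.
have k0 : (0 < k)%N by near: k; exact: nbhs_infty_gt.
have ck : c0 / k%:R `^ d <= c k by near: k.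
have [ek eS] := step k k0; have [eSk _] := step k.+1 isT.
have kd := powR_nat_ge1 k0 d0.
split => //; last exact: phiP.
  by rewrite invr_ge0 powR_ge0 invf_le1// (lt_le_trans ltr01).
apply: le_trans eS; rewrite ler_wpM2l// lerD2l -mulrA ler_wpM2l// ltW//.
Unshelve. all: by end_near. Qed.

(** Since [d <= 1], the terms [c k] dominate a multiple of the harmonic sequence,
    so the comparison with [phi = ln] applies whatever [d] is. *)
Lemma gap_cvg0 e c d kappa : 0 < kappa -> 0 <= d <= 1 ->
  (forall k, (0 < k)%N -> 0 <= e k /\ e k.+1 * (1 + kappa * c k) <= e k) ->
  (exists2 c0, 0 < c0 & \forall k \near \oo, c0 / k%:R `^ d <= c k) ->
  forall eps, 0 < eps -> \forall k \near \oo, e k < eps.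
Proof.
move=> kappa0 /andP[d0 d1] step [c0 c00 cP] eps eps0.
have [||nu [C [nu0 C0 eP]]] :=
    @gap_decay e c (fun k => ln k%:R) 1 kappa kappa0 ler01 step.
- exists c0 => //; near=> k.
  have k0 : (0 < k)%N by near: k; exact: nbhs_infty_gt.
  apply: (@le_trans _ _ (c0 / k%:R `^ d)); last by near: k.
  rewrite ler_wpM2l ?(ltW c00)// lef_pV2 ?posrE ?powR_gt0 ?ltr0n//.
  by rewrite ler_powR ?ler1n.
- exact: ln_nat_increment.
have dl0 : 0 < eps / (C + 1) by rewrite divr_gt0 ?ltr_wpDl.
near=> k.
have k0 : (0 < k)%N by near: k; exact: nbhs_infty_gt.
have kK : expR (- ln (eps / (C + 1)) / nu) < k%:R.
  by near: k; exact: nbhs_infty_gtr.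
apply: (@le_lt_trans _ _ (C * expR (- (nu * ln k%:R)))); first by near: k.
apply: (@le_lt_trans _ _ (C * (eps / (C + 1)))).
  rewrite ler_wpM2l// -[leRHS]lnK ?posrE// ler_expR lerNl.
  rewrite [leRHS]mulrC -ler_pdivrMr// -[leLHS]expRK.
  rewrite ler_ln ?posrE ?expR_gt0 ?ltr0n//.
  exact: ltW.
by rewrite mulrA ltr_pdivrMr ?ltr_wpDl// [ltRHS]mulrDr mulr1 mulrC ltrDl.
Unshelve. all: by end_near. Qed.

End Rates.

(** The relative gain over the iterations [2 k] and [2 k + 1]: the first term
    measures how far the inertia is from 1, the second how far the step size is
    from [1 / L]. *)
Definition damping (R : realType) (L gamma : R) (alpha : nat -> R)
    (k : nat) : R :=
  (1 - alpha (2 * k)%N) + (1 - gamma * L).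

Definition damped (R : realType) (L gamma : R) (alpha : nat -> R) (d : R) :=
  exists2 c0, 0 < c0 &
    \forall k \near \oo, c0 / k%:R `^ d <= damping L gamma alpha k.

Lemma damped_of_lower_bound (R : realType) (L gamma b : R) (alpha : nat -> R) :
  0 < b -> (forall k, b <= damping L gamma alpha k) -> damped L gamma alpha 0.
Proof.
move=> b0 bc; exists b => //.
by apply: nearW => k; rewrite powRr0 divr1.
Qed.

Lemma regime_a_damped (R : realType) (L gamma : R) (alpha : nat -> R) :
  0 < L -> (forall k, 0 <= alpha k <= 1) ->
  regime_a L gamma alpha -> gamma * L <= 1 /\ damped L gamma alpha 0.
Proof.
move=> L0 alpha01 [gL|[-> [a [a1 alphaa]]]].
  have gL1 : gamma * L < 1 by rewrite -ltr_pdivlMr// div1r.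
  split; first exact: ltW.
  apply: (@damped_of_lower_bound _ _ _ (1 - gamma * L)) => [|k].
    by rewrite subr_gt0.
  by rewrite lerDr subr_ge0; case/andP: (alpha01 (2 * k)%N).
split; first by rewrite mulVf ?gt_eqF.
apply: (@damped_of_lower_bound _ _ _ (1 - a)) => [|k]; first by rewrite subr_gt0.
by rewrite /damping mulVf ?gt_eqF// subrr addr0 lerD2l lerN2.
Qed.

(** Only even indices enter the damping; this costs the factor [2^d]. *)
Lemma rate_damped (R : realType) (L gamma d : R) (alpha : nat -> R) :
  0 < L -> gamma = L^-1 -> cvg_to_one_at_rate alpha d ->
  gamma * L <= 1 /\ damped L gamma alpha d.
Proof.
move=> L0 -> [c1 [c2 [c10 _ [N _ alphaP]]]].
split; first by rewrite mulVf ?gt_eqF.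
exists (c1 / 2 `^ d); first by rewrite divr_gt0// powR_gt0.
exists N => // k /= Nk; rewrite /damping mulVf ?gt_eqF// subrr addr0.
have /= := alphaP (2 * k)%N; rewrite (leq_trans Nk) ?leq_pmull// => /(_ isT).
by move=> /andP[+ _]; rewrite natrM powRM// invfM mulrA.
Qed.

(** * The alternated inertia iterates *)

Section AlternatedInertia.
Context {R : realType} {n : nat}.
Variables (f : 'rV[R]_n -> R) (g F : 'rV[R]_n -> \bar R) (L mu gamma : R).
Variables (alpha : nat -> R) (x y : nat -> 'rV[R]_n) (xs : 'rV[R]_n).
Hypotheses (f_convex : convex_function [set: convex_lmodType 'rV[R]_n] f)
  (f_diff : forall z, differentiable f z) (f_smooth : lipschitz_grad L f)
  (g_convex : convex_ereal g) (g_proper : proper_ereal g)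
  (g_lsc : lower_semicontinuous g)
  (F_def : F = (fun z => ((f z)%:E + g z)%E)) (xs_min : argmin F xs)
  (mu_gt0 : 0 < mu) (F_strong : strongly_convex_ereal mu F)
  (gamma_gt0 : 0 < gamma) (gammaL : gamma * L <= 1)
  (alpha01 : forall k, 0 <= alpha k <= 1)
  (algorithm : alternated_inertia (prox_grad gamma f g) alpha x y).

Local Notation T := (prox_grad gamma f g).
Let Phi z := f z + fine (g z).
Let gap k := Phi (y (2 * k)%N) - Phi xs.
Local Notation damping := (damping L gamma alpha).
Local Notation damped := (damped L gamma alpha).
Let kappa_gt0 := contraction_constant_gt0 gamma_gt0 mu_gt0.

Lemma minimizer_fin_num w : argmin F w -> g w \is a fin_num.
Proof.
move=> wmin; case: g_proper => gNoo [z gz].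
have := wmin z; rewrite F_def fin_numE gNoo /=.
by case gwE : (g w) => [r| |] //; case gzE : (g z) gz => [r| |].
Qed.

Let gxs_fin : g xs \is a fin_num := minimizer_fin_num xs_min.

Lemma F_fineE z : g z \is a fin_num -> F z = (Phi z)%:E.
Proof. by move=> gz; rewrite F_def /Phi EFinD fineK. Qed.

(** Fermat's rule at the minimizer: [- grad f xs] is a subgradient of [g]. This
    is the affine minorant that makes proximal points exist. *)
Lemma minimizer_minorant z : (g xs + (- dotp (grad f xs) (z - xs))%:E <= g z)%E.
Proof.
apply: (@min_tangent _ _ f g _ _ (L / 2)) => //.
  by move=> u; have := xs_min u; rewrite F_def.
by move=> h; exact: descent_inequality.
Qed.

(** Strong convexity at the midpoint of [z] and [xs]; this loses a factor 2
    against the optimal [mu / 2]. *)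
Lemma quadratic_growth z : g z \is a fin_num ->
  mu / 4 * dotp (z - xs) (z - xs) <= Phi z - Phi xs.
Proof.
move=> gz; have half01 : 0 <= (2^-1 : R) <= 1 by lra.
have := le_trans (xs_min _) (F_strong z xs half01).
rewrite !F_fineE// -!EFinM -!EFinD lee_fin enorm_sqr; lra.
Qed.

Lemma argmin_unique : argmin F = [set xs].
Proof.
apply/seteqP; split => [z zmin|_ ->] //=.
have gz := minimizer_fin_num zmin.
have := zmin xs; rewrite !F_fineE// lee_fin => zxs.
have := quadratic_growth gz; rewrite -enorm_sqr => growth.
have : enorm (z - xs) ^+ 2 = 0.
  have mu4 : 0 < mu / 4 by rewrite divr_gt0.
  apply/eqP; rewrite eq_le sqr_ge0 andbT -(pmulr_rle0 _ mu4).
  by apply: le_trans growth _; rewrite subr_le0.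
by move=> /eqP; rewrite sqrf_eq0 => /eqP/enorm_eq0/eqP; rewrite subr_eq0 => /eqP.
Qed.

Lemma ereal_inf_range : ereal_inf (range F) = F xs.
Proof.
apply/eqP; rewrite eq_le; apply/andP; split.
  by apply: ereal_inf_lbound; exists xs.
by apply: le_ereal_inf_tmp => _ [z _ <-]; exact: xs_min.
Qed.

Lemma three_point u :
  g (T u) \is a fin_num /\
  forall z, g z \is a fin_num ->
    Phi (T u) + gamma^-1 / 2 * dotp (T u - z) (T u - z)
      + (gamma^-1 - L) / 2 * dotp (T u - u) (T u - u)
    <= Phi z + gamma^-1 / 2 * dotp (u - z) (u - z).
Proof.
exact: (prox_grad_three_point g_proper gamma_gt0 u f_convex f_diff f_smooth
  g_convex g_lsc gxs_fin minimizer_minorant).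
Qed.

(** The index 0 is excluded: [x 0] and [y 0] are unrelated, and [F] may be
    infinite at both. *)
Lemma even_iterate k : (0 < k)%N ->
  x (2 * k)%N = y (2 * k)%N /\ g (y (2 * k)%N) \is a fin_num.
Proof.
case: k => // k _; rewrite mulnS.
have [|_ _ y2 x2] := algorithm (k := (2 * k)%N); first by rewrite oddM.
by rewrite x2 y2; split => //; case: (three_point (x (2 * k).+1)).
Qed.

Lemma gap_recursion k : (0 < k)%N ->
  0 <= gap k /\
  gap k.+1 * (1 + contraction_constant gamma mu * damping k) <= gap k.
Proof.
move=> k0; have [xy gy] := even_iterate k0; split.
  apply: le_trans (quadratic_growth gy).
  by rewrite mulr_ge0 ?dotp_ge0// divr_ge0// ltW.
rewrite /gap mulnS.
have [|y1 x1 y2 _] := algorithm (k := (2 * k)%N); first by rewrite oddM.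
rewrite [(2 + _)%N]/= y2 x1 y1 xy.
exact: (@two_step_contraction _ _ Phi [set z | g z \is a fin_num]
  (prox_grad gamma f g)) three_point quadratic_growth gy gxs_fin.
Qed.

Lemma enorm_sqr_le_gap k : (0 < k)%N ->
  enorm (y (2 * k)%N - xs) ^+ 2 <= 4 / mu * gap k.
Proof.
move=> k0; have [_ gy] := even_iterate k0.
rewrite -ler_pdivrMl ?divr_gt0// enorm_sqr invf_div.
exact: quadratic_growth.
Qed.

Lemma exponential_gap d : 0 <= d -> damped d ->
  exists nu C : R, [/\ 0 < nu, 0 <= C &
    \forall k \near \oo, gap k <= C * expR (- (nu * k%:R `^ (1 - d)))].
Proof.
move=> d0 dd; apply: (gap_decay kappa_gt0 d0 gap_recursion dd) => k k0.
exact: powR_nat_increment.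
Qed.

Lemma damped_objective_rate d : 0 <= d -> damped d -> objective_rate F y d.
Proof.
move=> d0 /(exponential_gap d0)[nu [C [nu0 C0 gapC]]].
exists nu; split => //; exists C; near=> k.
have k0 : (0 < k)%N by near: k; exact: nbhs_infty_gt.
have [_ gy] := even_iterate k0; have [gap0 _] := gap_recursion k0.
rewrite ereal_inf_range !F_fineE// -EFinB /= lee_fin.
by rewrite (ger0_norm gap0) (ger0_norm (expR_ge0 _)); near: k.
Unshelve. all: by end_near. Qed.

Lemma damped_iterates_rate d : 0 <= d -> damped d -> iterates_rate xs y d.
Proof.
move=> d0 /(exponential_gap d0)[nu [C [nu0 C0 gapC]]].
exists (nu / 2); split; first by rewrite divr_gt0.
have M0 : 0 <= 4 / mu * C by rewrite mulr_ge0// divr_ge0// ltW.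
(* Adding 1 keeps the constant positive when [C = 0]. *)
apply/eqO_exP; exists (Num.sqrt (4 / mu * C) + 1).
  by rewrite ltr_wpDl// sqrtr_ge0.
near=> k.
have k0 : (0 < k)%N by near: k; exact: nbhs_infty_gt.
rewrite (ger0_norm (enorm_ge0 _)) (ger0_norm (expR_ge0 _)).
apply: (@le_trans _ _
  (Num.sqrt (4 / mu * C) * expR (- (nu / 2 * k%:R `^ (1 - d))))); last first.
  by rewrite ler_wpM2r ?expR_ge0// lerDl.
rewrite -(@ler_pXn2r _ 2)// ?nnegrE ?enorm_ge0 ?mulr_ge0 ?sqrtr_ge0 ?expR_ge0//.
have expR_half : expR (- (nu / 2 * k%:R `^ (1 - d))) ^+ 2 =
    expR (- (nu * k%:R `^ (1 - d))).
  by rewrite expr2 -expRD -opprD -mulrDl -splitr.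
rewrite [leRHS]exprMn [X in X * _]sqr_sqrtr// expR_half.
apply: le_trans (enorm_sqr_le_gap k0) _.
by rewrite -[leRHS]mulrA ler_wpM2l ?divr_ge0 ?(ltW mu_gt0)//; near: k.
Unshelve. all: by end_near. Qed.

Lemma damped_cvg d : 0 <= d <= 1 -> damped d ->
  (fun k => y (2 * k)%N) @ \oo --> xs.
Proof.
move=> d01 dd; apply/cvgrPdist_lt => eps eps0.
have e0 : 0 < eps ^+ 2 / (4 / mu) by rewrite divr_gt0 ?exprn_gt0// divr_gt0.
have gap_small := gap_cvg0 kappa_gt0 d01 gap_recursion dd e0.
near=> k.
have k0 : (0 < k)%N by near: k; exact: nbhs_infty_gt.
rewrite distrC; apply: le_lt_trans (mx_norm_le_enorm _) _.
rewrite -(@ltr_pXn2r _ 2)// ?nnegrE ?enorm_ge0 ?(ltW eps0)//.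
apply: le_lt_trans (enorm_sqr_le_gap k0) _.
by rewrite mulrC -ltr_pdivlMr ?divr_gt0//; near: k.
Unshelve. all: by end_near. Qed.

End AlternatedInertia.

(** * Rates and convergence in the three regimes *)

Theorem proposition4p1 (R : realType) (n : nat)
    (f : 'rV[R]_n -> R) (g F : 'rV[R]_n -> \bar R)
    (L mu gamma : R) (alpha : nat -> R) (x y : nat -> 'rV[R]_n)
    (L_gt0 : 0 < L)
    (f_convex : convex_function [set: convex_lmodType 'rV[R]_n] f)
    (f_diff : forall z, differentiable f z)
    (f_smooth : lipschitz_grad L f)
    (g_convex : convex_ereal g)
    (g_proper : proper_ereal g)
    (g_lsc : lower_semicontinuous g)
    (F_def : F = (fun z => ((f z)%:E + g z)%E))
    (F_argmin : argmin F !=set0)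
    (mu_gt0 : 0 < mu)
    (F_strong : strongly_convex_ereal mu F)
    (gamma_gt0 : 0 < gamma)
    (alpha01 : forall k, 0 <= alpha k <= 1)
    (regimes : [\/ regime_a L gamma alpha,
                   exists d, regime_b L gamma alpha d |
                   regime_c L gamma alpha])
    (algorithm : alternated_inertia (prox_grad gamma f g) alpha x y) :
  (regime_a L gamma alpha -> objective_rate F y 0) /\
  (forall d, regime_b L gamma alpha d -> objective_rate F y d) /\
  exists xstar, [/\ argmin F = [set xstar],
    (fun k => y (2 * k)%N) @ \oo --> xstar,
    regime_a L gamma alpha -> iterates_rate xstar y 0 &
    forall d, regime_b L gamma alpha d -> iterates_rate xstar y d].
Proof.
have [xs xs_min] := F_argmin.
have damped_b d : regime_b L gamma alpha d ->
    [/\ 0 <= d, gamma * L <= 1 & damped L gamma alpha d].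
  by move=> [gE /andP[/ltW d0 _] /(rate_damped L_gt0 gE)[]].
have damped_a := @regime_a_damped _ L gamma alpha L_gt0 alpha01.
have rates d : 0 <= d -> gamma * L <= 1 -> damped L gamma alpha d ->
    objective_rate F y d /\ iterates_rate xs y d.
  move=> d0 gL dd; split.
    exact: (damped_objective_rate f_convex f_diff f_smooth g_convex g_proper
      g_lsc F_def xs_min mu_gt0 F_strong gamma_gt0 gL alpha01 algorithm d0 dd).
  exact: (damped_iterates_rate f_convex f_diff f_smooth g_convex g_proper
    g_lsc F_def xs_min mu_gt0 F_strong gamma_gt0 gL alpha01 algorithm d0 dd).
split; [|split].
- by move=> /damped_a[gL /(rates _ (lexx 0) gL)[]].
- by move=> d /damped_b[d0 gL /(rates _ d0 gL)[]].
have [d [d01 gL dd]] : exists d,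
    [/\ 0 <= d <= 1, gamma * L <= 1 & damped L gamma alpha d].
  case: regimes => [/damped_a[gL dd]|[d] rb|[gE /(rate_damped L_gt0 gE)[gL dd]]].
  - by exists 0; rewrite lexx ler01.
  - have [d0 gL dd] := damped_b d rb; exists d; split => //.
    by rewrite d0; case: rb => _ /andP[_ /ltW].
  - by exists 1; rewrite lexx ler01.
exists xs; split.
- exact: argmin_unique g_proper F_def xs_min mu_gt0 F_strong.
- exact: (damped_cvg f_convex f_diff f_smooth g_convex g_proper g_lsc F_def
    xs_min mu_gt0 F_strong gamma_gt0 gL alpha01 algorithm d01 dd).
- by move=> /damped_a[gL' /(rates _ (lexx 0) gL')[]].
- by move=> d' /damped_b[d0 gL' /(rates _ d0 gL')[]].
Qed.
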